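(* For every dimension $d$, the minimum number $f(d)$ of boxes in a double cover of $\{0,1,2\}^d$ satisfies $$f(d)\ \ge\ \frac{2^{d+1}}{d+1}.$$
   Context: Write $[3]=\{0,1,2\}$. A proper sub-box of $[3]^d$ is a set $B=S_1\times\dots\times S_d$ with $\varnothing\neq S_i\subsetneq[3]$ for every $1\le i\le d$ (so each side $S_i$ has one or two elements). A double cover of $[3]^d$ is a finite multiset $\{B_1,\dots,B_m\}$ of proper sub-boxes such that every point of $[3]^d$ lies in exactly two of the $B_j$, counted with multiplicity; its size is $m$. $f(d)$ denotes the minimum size of a double cover of $[3]^d$. *)

(* Defs.v *)
From mathcomp Require Import all_boot all_order all_algebra.

Set Implicit Arguments.
Unset Strict Implicit.
Unset Printing Implicit Defensive.

Definition point (d : nat) := {ffun 'I_d -> 'I_3}.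

Definition box (d : nat) (S : {ffun 'I_d -> {set 'I_3}}) : {set point d} :=
  [set x : point d | [forall i, x i \in S i]].

Definition proper_box (d : nat) (B : {set point d}) : bool :=
  [exists S : {ffun 'I_d -> {set 'I_3}},
    [forall i, (S i != set0) && (S i \proper [set: 'I_3])] && (B == box S)].

(* Sequences of boxes stand for multisets: the predicate and the size are
   invariant under permutation, and [count] takes multiplicity into account. *)
Definition double_cover (d : nat) (s : seq {set point d}) : bool :=
  all (@proper_box d) s &&
  [forall x : point d, count (fun B : {set point d} => x \in B) s == 2].

Definition has_double_cover (d m : nat) : bool :=
  [exists t : m.-tuple {set point d}, double_cover t].

Lemma proper_box_singleton (d : nat) (x : point d) : proper_box [set x].
Proof.
apply/existsP; exists [ffun i => [set x i]]; apply/andP; split.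
  apply/forallP => i; rewrite ffunE -card_gt0 cards1 /=.
  by rewrite properEcard subsetT cards1 cardsT card_ord.
apply/eqP/setP => y; rewrite !inE; apply/eqP/forallP => [-> i|yx].
  by rewrite ffunE inE.
by apply/ffunP => i; have := yx i; rewrite ffunE inE => /eqP.
Qed.

Lemma double_cover_exists (d : nat) : exists m, has_double_cover d m.
Proof.
pose e := [seq [set x] | x : point d].
exists (size (e ++ e)); apply/existsP; exists (in_tuple (e ++ e)) => /=.
apply/andP; split.
  rewrite all_cat andbb; apply/allP => B /mapP [x _ ->].
  exact: proper_box_singleton.
apply/forallP => x; rewrite count_cat count_map.
have -> : count (preim (fun y : point d => [set y])
    (fun B : {set point d} => x \in B)) (enum (point d)) = 1.
  rewrite (eq_count (a2 := pred1 x)); last by move=> y; rewrite /= inE eq_sym.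
  by rewrite count_uniq_mem ?enum_uniq // mem_enum.
by [].
Qed.

Definition min_double_cover (d : nat) : nat := ex_minn (double_cover_exists d).

(* Main.v *)
(** Intersect the cover with a test box [R], each side of which is a singleton
    or all of [[3]].  The number of points of [R] is odd, so the sizes
    [#|R :&: B_j|] add up to 2 modulo 4.  Hence, for a uniformly random [R],
    either two of them are odd or one of them is 2 modulo 4.  For a fixed proper
    box the first event has probability [2^-d] and the second, which needs one
    factor 2 and all others odd, at most [d/2 * 2^-d].  Counting the second
    event twice gives [2 <= m * (d + 1) / 2^d]. *)
Require Import Defs.
From mathcomp Require Import all_boot all_order all_algebra.
From mathcomp Require Import zify.

Set Implicit Arguments.
Unset Strict Implicit.
Unset Printing Implicit Defensive.

Local Open Scope ring_scope.

(** Distance from [n] to the nearest multiple of 4 (the Lee weight modulo 4). Being subadditive, it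
    lets an odd intersection count once and one that is 2 modulo 4 count twice. *)
Definition weight4 (n : nat) : nat := nth 0%N [:: 0; 1; 2; 1]%N (n %% 4).

Lemma weight4D m n : (weight4 (m + n) <= weight4 m + weight4 n)%N.
Proof.
rewrite /weight4 -modnDm.
move: (m %% 4)%N (n %% 4)%N (ltn_pmod m (isT : 0 < 4)%N)
  (ltn_pmod n (isT : 0 < 4)%N).
by case=> [|[|[|[|?]]]] // [|[|[|[|?]]]].
Qed.

Lemma weight4_sum (T : Type) (s : seq T) (F : T -> nat) :
  (weight4 (\sum_(t <- s) F t) <= \sum_(t <- s) weight4 (F t))%N.
Proof.
elim/big_rec2: _ => // t m n _ le_nm.
by apply: leq_trans (weight4D _ _) _; rewrite leq_add2l.
Qed.

Lemma weight4_le2 n : (weight4 n <= 2)%N.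
Proof.
rewrite /weight4; move: (n %% 4)%N (ltn_pmod n (isT : 0 < 4)%N).
by case=> [|[|[|[|?]]]].
Qed.

Lemma weight4_odd n : odd n -> weight4 n = 1%N.
Proof.
rewrite /weight4 -(@odd_mod n 4) //.
move: (n %% 4)%N (ltn_pmod n (isT : 0 < 4)%N).
by case=> [|[|[|[|?]]]].
Qed.

Lemma weight4_dvd n : (4 %| n)%N -> weight4 n = 0%N.
Proof. by rewrite /weight4 => /eqP ->. Qed.

Lemma weight4_double_odd n : odd n -> weight4 (n * 2) = 2%N.
Proof. by move=> n_odd; rewrite /weight4; have -> : (n * 2 %% 4 = 2)%N by lia. Qed.

Lemma odd_prod (I : finType) (F : I -> nat) :
  (forall i, odd (F i)) -> odd (\prod_i F i)%N.
Proof. by move=> oddF; apply: (big_ind odd) => // m n; rewrite oddM => -> ->. Qed.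

(** Two even factors, or a factor 0, make the product divisible by 4, so a nonzero weight leaves at
    most one even factor, equal to 2. Both surviving cases are written as products over coordinates
    so that sums over all test boxes factorize. *)
Lemma weight4_prod (I : finType) (n : I -> nat) : (forall i, n i <= 2)%N ->
  (weight4 (\prod_i n i) <= \prod_i odd (n i)
     + \sum_i \prod_k (if k == i then 2 * (n k == 2) else odd (n k)))%N.
Proof.
move=> n_le2; have [/forallP n_odd|/forallPn[i n_even]] :=
  boolP [forall i, odd (n i)].
  rewrite weight4_odd ?odd_prod // big1 // => i _; by rewrite n_odd.
have [/existsP[k /andP[k_neq_i k_even]]|/existsPn oddk] :=
  boolP [exists k, (k != i) && ~~ odd (n k)].
  rewrite weight4_dvd // (bigD1 i) //= (bigD1 k) //= mulnA dvdn_mulr //.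
  by rewrite (@dvdn_mul 2 2) // dvdn2.
have [ni0|ni2] : n i = 0%N \/ n i = 2%N.
  by move: (n_le2 i) n_even; case: (n i) => [|[|[|?]]] //; [left|right].
  by rewrite (bigD1 i) //= ni0 mul0n.
(* The only even factor is [n i = 2], so the summand of index [i] alone equals 2, the largest
   possible weight. *)
apply: leq_trans (weight4_le2 _) _.
rewrite (bigD1 i (F := fun i => \prod_k _)) //=.
rewrite (bigD1 i (F := fun k => if k == i then _ else _)) //= eqxx ni2 /=.
rewrite [X in (_ * X + _)%N]big1 => [|k k_neq_i]; last first.
  by have := oddk k; rewrite k_neq_i (negPf k_neq_i) /= negbK => ->.
lia.
Qed.

Lemma card_box d (S : {ffun 'I_d -> {set 'I_3}}) :
  #|box S| = (\prod_i #|S i|)%N.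
Proof.
have -> : #|box S| = #|family (fun i => mem (S i))|.
  apply: eq_card => x; rewrite inE; apply/forallP/familyP => xS i.
    exact: xS.
  exact: xS.
by rewrite card_family foldrE big_map big_enum.
Qed.

(** [None] encodes the full side: four choices per coordinate, each of odd size. *)
Definition test_side (o : option 'I_3) : {set 'I_3} :=
  if o is Some a then [set a] else setT.

Definition test_box d (r : {ffun 'I_d -> option 'I_3}) : {set point d} :=
  box [ffun i => test_side (r i)].

Lemma odd_test_side o : odd #|test_side o|.
Proof. by case: o => [a|] /=; rewrite ?cards1 // cardsT card_ord. Qed.

Lemma card_test_boxI d (r : {ffun 'I_d -> option 'I_3}) S :
  #|test_box r :&: box S| = (\prod_i #|test_side (r i) :&: S i|)%N.
Proof.
have -> : test_box r :&: box S = box [ffun i => test_side (r i) :&: S i].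
  apply/setP => x; rewrite !inE; apply/andP/forallP.
    by case=> /forallP xr /forallP xS i; have := xr i; rewrite !ffunE inE xS => ->.
  move=> x_rS; split; apply/forallP => i; have := x_rS i; rewrite !ffunE inE;
    by case/andP.
by rewrite card_box; apply: eq_bigr => i _; rewrite ffunE.
Qed.

Lemma sum_option (T : finType) (F : option T -> nat) :
  (\sum_o F o = F None + \sum_a F (Some a))%N.
Proof.
rewrite (bigD1 None) //= (reindex_omap Some id) => [|[]] //=.
by under eq_bigl do rewrite eqxx.
Qed.

Lemma card_test_sideI_some a (s : {set 'I_3}) :
  #|test_side (Some a) :&: s| = (a \in s) :> nat.
Proof.
case: (boolP (a \in s)) => a_s /=.
  by rewrite (setIidPl _) ?cards1 // sub1set.
by apply/eqP; rewrite cards_eq0 setI_eq0 disjoints1.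
Qed.

Lemma card_proper_side (s : {set 'I_3}) :
  s != set0 -> s \proper [set: 'I_3] -> #|s| = 1%N \/ #|s| = 2%N.
Proof.
rewrite -card_gt0 => + /proper_card; rewrite cardsT card_ord.
by case: #|s| => [|[|[|?]]] //; [left|right].
Qed.

(** A one-element side is met oddly by its own singleton and by the full side, a two-element side by
    its two singletons only. *)
Lemma sum_odd_test_side (s : {set 'I_3}) :
  s != set0 -> s \proper [set: 'I_3] ->
  (\sum_o odd #|test_side o :&: s| = 2)%N.
Proof.
move=> s_n0 s_prop; rewrite sum_option setTI.
under eq_bigr => a _ do rewrite card_test_sideI_some oddb.
by rewrite -big_mkcond /= sum1_card; case: (card_proper_side s_n0 s_prop) => ->.
Qed.

(** Only the full side can meet [s] in two points. *)
Lemma sum_two_test_side (s : {set 'I_3}) :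
  (\sum_o 2 * (#|test_side o :&: s| == 2) <= 2)%N.
Proof.
rewrite sum_option big1 => [|a _]; last by rewrite card_test_sideI_some; case: (_ \in _).
by rewrite addn0; case: (_ == _).
Qed.

Lemma sum_weight4_test_box d (B : {set point d}) : proper_box B ->
  (\sum_(r : {ffun 'I_d -> option 'I_3}) weight4 #|test_box r :&: B|
     <= d.+1 * 2 ^ d)%N.
Proof.
case/existsP => S /andP[/forallP S_proper /eqP ->].
have sum_odd i : (\sum_o odd #|test_side o :&: S i| = 2)%N.
  by case/andP: (S_proper i); exact: sum_odd_test_side.
have side_le2 o i : (#|test_side o :&: S i| <= 2)%N.
  apply: leq_trans (subset_leq_card (subsetIr _ _)) _.
  by case/andP: (S_proper i) => n0 pr; case: (card_proper_side n0 pr) => ->.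
under eq_bigr => r _ do rewrite card_test_boxI.
apply: (@leq_trans (\sum_(r : {ffun 'I_d -> option 'I_3}) _)).
  by apply: leq_sum => r _; exact: weight4_prod.
(* The all-odd term contributes [2 ^ d], and each of the [d] positions of the factor 2 at most
   [2 ^ d]: exchanging sum and product leaves one sum per coordinate, bounded by 2. *)
rewrite big_split exchange_big /= mulSn leq_add //.
  rewrite -(bigA_distr_bigA (fun i o => nat_of_bool (odd #|test_side o :&: S i|))).
  by rewrite (eq_bigr _ (fun i _ => sum_odd i)) prod_nat_const card_ord.
rewrite -[d in (d * _)%N]card_ord -sum_nat_const; apply: leq_sum => i _.
rewrite -(bigA_distr_bigA (fun k o => if k == i
  then 2 * (#|test_side o :&: S k| == 2) else odd #|test_side o :&: S k|))%N.
rewrite -[d in (2 ^ d)%N]card_ord -prod_nat_const; apply: leq_prod => k _.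
by case: (k == i); rewrite ?sum_odd // sum_two_test_side.
Qed.

(** Each point of the test box is covered twice, so the intersection sizes add up to twice an odd
    number, of weight 2; subadditivity does the rest. *)
Lemma sum_weight4_double_cover d (s : seq {set point d}) r : double_cover s ->
  (2 <= \sum_(B <- s) weight4 #|test_box r :&: B|)%N.
Proof.
case/andP => _ /forallP cover2; apply: leq_trans (weight4_sum _ _).
have -> : (\sum_(B <- s) #|test_box r :&: B| = #|test_box r| * 2)%N.
  rewrite -sum_nat_const.
  under eq_bigr => B _ do rewrite -sum1_card
    (eq_bigl _ _ (fun x => in_setI x (test_box r) B)) big_mkcondr.
  rewrite exchange_big; apply: eq_bigr => x _.
  by rewrite -big_mkcond sum1_count; exact/eqP/cover2.
rewrite weight4_double_odd // card_box odd_prod // => i.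
by rewrite ffunE odd_test_side.
Qed.

(** The total weight over pairs of a test box and a member of [s] is bounded below per test box and
    above per member. *)
Lemma double_cover_size d (s : seq {set point d}) :
  double_cover s -> (2 ^ d.+1 <= size s * d.+1)%N.
Proof.
move=> cover_s; have /andP[/allP proper_s _] := cover_s.
have lower : (4 ^ d * 2 <= \sum_(r : {ffun 'I_d -> option 'I_3})
    \sum_(B <- s) weight4 #|test_box r :&: B|)%N.
  have <- : #|{ffun 'I_d -> option 'I_3}| = (4 ^ d)%N.
    by rewrite card_ffun card_option !card_ord.
  rewrite -sum_nat_const; apply: leq_sum => r _.
  exact: sum_weight4_double_cover.
have upper : (\sum_(r : {ffun 'I_d -> option 'I_3})
    \sum_(B <- s) weight4 #|test_box r :&: B| <= size s * (d.+1 * 2 ^ d))%N.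
  rewrite exchange_big /= -sum1_size big_distrl /= big_seq [X in (_ <= X)%N]big_seq.
  by apply: leq_sum => B B_s; rewrite mul1n sum_weight4_test_box ?proper_s.
have := leq_trans lower upper.
(* Writing [4 ^ d] as [2 ^ d * 2 ^ d] lets one factor [2 ^ d] cancel. *)
rewrite (_ : 4 = 2 * 2)%N // expnMn mulnA -mulnA -expnSr mulnC.
by rewrite leq_pmul2r ?expn_gt0.
Qed.

Theorem theorem3p1 (d : nat) :
  2 ^+ d.+1 / d.+1%:R <= (min_double_cover d)%:R :> rat.
Proof.
rewrite Num.Theory.ler_pdivrMr ?Num.Theory.ltr0Sn //.
rewrite -GRing.natrX -GRing.natrM Num.Theory.ler_nat /min_double_cover.
case: ex_minnP => m /existsP[t cover_t] _.
by rewrite -(size_tuple t) double_cover_size.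
Qed.
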